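(* Up to isomorphism, there are exactly eight $3$-dicritical semi-complete digraphs, namely: (1) $\overleftrightarrow{K_3}$, the bidirected complete graph on 3 vertices (three vertices, all six arcs); (2) $\vec{W_3}$: a directed triangle $a\to b\to c\to a$ together with a vertex $r$ joined by a digon to each of $a,b,c$; (3) $\mathcal{H}_5$: vertex set $\{u_0,\dots,u_4\}$, with digons between $u_0$ and $u_1$ and between $u_0$ and $u_4$, and the simple arcs $u_4u_1$, $u_1u_3$, $u_1u_2$, $u_3u_4$, $u_2u_4$, $u_3u_0$, $u_0u_2$, $u_2u_3$; (4)–(7) the four digraphs $\mathcal{R}(H_1,H_2)$ with $H_1,H_2\in\{\overleftrightarrow{K_2},\vec{C_3}\}$; (8) the Paley tournament $\mathcal{P}_7$ with vertex set $\mathbb{Z}_7$ and arcs $i\to i+1$, $i\to i+2$, $i\to i+4$ for all $i\in\mathbb{Z}_7$.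
   Context: Digraphs are finite, with no loops and no parallel arcs; a digon is a pair of arcs $uv,vu$. A $2$-dicolouring of $D$ is a map $V(D)\to\{1,2\}$ such that each colour class induces an acyclic subdigraph (a digon is a directed cycle). $D$ is $3$-dicritical if $D$ has no $2$-dicolouring but every proper subdigraph has one. $D$ is semi-complete if every two distinct vertices are joined by at least one arc. $\overleftrightarrow{K_2}$ is a digon on two vertices; $\vec{C_3}$ is the directed triangle. For digraphs $H_1,H_2$, $\mathcal{R}(H_1,H_2)$ is the digraph obtained from disjoint copies of $H_1$ and $H_2$ and one new vertex $r$ by adding all arcs from $r$ to every vertex of $H_1$, all arcs from every vertex of $H_1$ to every vertex of $H_2$, and all arcs from every vertex of $H_2$ to $r$. *)

(* Defs.v *)
From mathcomp Require Import all_boot.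
Set Implicit Arguments. Unset Strict Implicit. Unset Printing Implicit Defensive.

(* A (finite) digraph, given by its vertex type and its (boolean) arc relation.
   Loops are excluded by an explicit irreflexivity hypothesis where relevant;
   parallel arcs cannot exist since arcs form a relation. *)
Record fdigraph := FDigraph { dv : finType; darc : rel dv }.
Arguments darc : clear implicits.

(* A directed cycle of a relation e: a nonempty duplicate-free sequence
   v_1 ... v_k with e v_1 v_2, ..., e v_{k-1} v_k, e v_k v_1
   (for k = 2 this is a digon). *)
Definition has_dicycle (T : eqType) (e : rel T) : Prop :=
  exists s : seq T, [/\ s != [::], uniq s & cycle e s].

Definition acyclic (T : eqType) (e : rel T) : Prop := ~ has_dicycle e.

(* The subdigraph with vertex set S and arcs B (arcs of B not inside S ignored)
   has a 2-dicolouring: a colouring c such that each colour class induces an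
   acyclic subdigraph. *)
Definition dicolourable2 (V : finType) (S : {set V}) (B : rel V) : Prop :=
  exists c : V -> bool, forall k : bool,
    acyclic (fun x y => [&& x \in S, y \in S, c x == k, c y == k & B x y]).

Definition dicritical3 (V : finType) (A : rel V) : Prop :=
  ~ dicolourable2 [set: V] A /\
  forall (S : {set V}) (B : rel V),
    (forall x y, B x y -> A x y) ->
    (S != [set: V] \/ exists x y, A x y && ~~ B x y) ->
    dicolourable2 S B.

Definition semicomplete (V : finType) (A : rel V) : Prop :=
  forall x y : V, x != y -> A x y || A y x.

Definition diso (G H : fdigraph) : Prop :=
  exists f : dv G -> dv H, bijective f /\
    forall x y, darc G x y = darc H (f x) (f y).

Definition of_arcs (n : nat) (l : seq (nat * nat)) : fdigraph :=
  @FDigraph 'I_n (fun x y : 'I_n => (nat_of_ord x, nat_of_ord y) \in l).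

Definition K3bi : fdigraph := @FDigraph 'I_3 (fun x y : 'I_3 => x != y).

Definition K2bi : fdigraph := @FDigraph 'I_2 (fun x y : 'I_2 => x != y).

Definition C3 : fdigraph := of_arcs 3 [:: (0,1); (1,2); (2,0)].

(* W_3: triangle a=0 -> b=1 -> c=2 -> a, and r=3 joined by a digon to each. *)
Definition W3 : fdigraph :=
  of_arcs 4 [:: (0,1); (1,2); (2,0); (3,0); (0,3); (3,1); (1,3); (3,2); (2,3)].

Definition H5 : fdigraph :=
  of_arcs 5 [:: (0,1); (1,0); (0,4); (4,0);
                (4,1); (1,3); (1,2); (3,4); (2,4); (3,0); (0,2); (2,3)].

(* R(H1,H2): new vertex r (None), copies of H1 (inl) and H2 (inr). *)
Definition Rdig (G1 G2 : fdigraph) : fdigraph :=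
  @FDigraph (option (dv G1 + dv G2))%type
    (fun x y => match x, y with
       | None, Some (inl _) => true
       | Some (inl a), Some (inl b) => darc G1 a b
       | Some (inl _), Some (inr _) => true
       | Some (inr a), Some (inr b) => darc G2 a b
       | Some (inr _), None => true
       | _, _ => false
       end).

Definition P7 : fdigraph :=
  @FDigraph 'I_7
    (fun x y : 'I_7 => ((y + 7 - x) %% 7) \in [:: 1; 2; 4]).

Definition eight : seq fdigraph :=
  [:: K3bi; W3; H5; Rdig K2bi K2bi; Rdig K2bi C3; Rdig C3 K2bi; Rdig C3 C3; P7].

(* Main.v *)
Require Import Defs.
From mathcomp Require Import all_boot.
Set Implicit Arguments. Unset Strict Implicit. Unset Printing Implicit Defensive.

(** In a semicomplete digraph, even with one arc removed, a set of vertices is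
    acyclic as soon as it contains no digon and no directed triangle.

    Let D be 3-dicritical and semicomplete, and let s be a set of vertices of D
    inducing a known digraph. Every arc uv of D has a labelling c, a 2-dicolouring
    of D - uv; it gives u and v the same colour. Take uv inside s and recolour s
    with a 2-dicolouring f of D[s], keeping c outside s. Since D is not
    2-dicolourable, a monochromatic digon or triangle appears; it contains one or
    two vertices outside s, whose links to s are restricted by c. So D contains
    one of finitely many one- or two-vertex extensions of D[s]. An extension is
    impossible if one of its arcs has no labelling at all; if it contains one of
    the eight digraphs, then D is that digraph. Repeating this, a search over 39
    configurations settles the digraphs with a digon, and one over 17
    configurations settles the tournaments, starting from a directed triangle. *)

(** * Link matrices and their colourings *)

Definition link := (bool * bool)%type.
Definition lmatrix := seq (seq link).

Definition link_of (V : Type) (e : rel V) (x y : V) : link := (e x y, e y x).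

(* The adjacency matrix above the diagonal: each vertex against the later ones.
   New vertices are consed in front. *)
Fixpoint rows (V : Type) (e : rel V) (s : seq V) : lmatrix :=
  if s is x :: s' then map (link_of e x) s' :: rows e s' else [::].

(* A monochromatic digon xy or triangle xyz; in the first case z is idle. *)
Definition mono (V : Type) (e : rel V) (c : V -> bool) (x y z : V) :=
  [&& c x == c y, c x == c z, e x y & e y x || e y z && e z x].

Definition good (V : eqType) (e : rel V) (c : V -> bool) (s : seq V) :=
  forall x y z, x \in s -> y \in s -> z \in s -> ~~ mono e c x y z.

(** Here [r] links the new vertex y to a vertex t, [rt] is the row of t, and [row] and [cs] hold the
    links of y to the vertices after t and their colours. Each pair is stored once, so both
    orientations of a triangle have to be tested. *)
Fixpoint bad2 (r : link) (rt row : seq link) (cs : seq bool) (b : bool) :=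
  match rt, row, cs with
  | z :: rt', r' :: row', c :: cs' =>
    (c == b) && (r.1 && z.1 && r'.2 || r.2 && z.2 && r'.1)
    || bad2 r rt' row' cs' b
  | _, _, _ => false
  end.

(* A new vertex with links [row] and colour [b] closes a monochromatic digon or
   triangle with the vertices of [m], coloured by [cs]. *)
Fixpoint bad (row : seq link) (m : lmatrix) (cs : seq bool) (b : bool) :=
  match row, m, cs with
  | r :: row', rt :: m', c :: cs' =>
    (c == b) && (r.1 && r.2 || bad2 r rt row' cs' b) || bad row' m' cs' b
  | _, _, _ => false
  end.

Fixpoint proper (m : lmatrix) (cs : seq bool) :=
  match m, cs with
  | row :: m', b :: cs' => ~~ bad row m' cs' b && proper m' cs'
  | _, _ => true
  end.

(** Colourings grow from the last vertex towards the first, so an improper partial colouring is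
    pruned at once. *)
Fixpoint colourings (m : lmatrix) : seq (seq bool) :=
  if m is row :: m' then
    flatten [seq [seq b :: cs | b <- [:: true; false] & ~~ bad row m' cs b]
            | cs <- colourings m']
  else [:: [::]].

Lemma mem_colourings m cs :
  (cs \in colourings m) = (size cs == size m) && proper m cs.
Proof.
elim: m cs => [|row m IH] [|b cs] //=.
  by apply/flatten_mapP => -[cs _] /mapP[].
rewrite eqSS; apply/flatten_mapP/idP => [[cs']|].
  rewrite IH => /andP[/eqP <- pr].
  by case: ifP => nt; case: ifP => nf; rewrite ?inE //= => h;
    (try case/orP: h => h); case/eqP: h => -> ->; rewrite eqxx ?nt ?nf pr.
case/and3P=> sz nb pr; exists cs; first by rewrite IH sz.
by case: b nb => ->; rewrite ?inE ?eqxx //; case: ifP; rewrite ?inE eqxx ?orbT.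
Qed.

(** * Matrices of digraphs *)

Section Rows.
Variables (V : eqType) (e : rel V).
Hypothesis irr_e : irreflexive e.
Implicit Types (s : seq V) (x y t : V).

Lemma size_rows s : size (rows e s) = size s.
Proof. by elim: s => //= x s ->. Qed.

Lemma bad2_rows (c : V -> bool) y t s b :
  bad2 (link_of e y t) (map (link_of e t) s) (map (link_of e y) s) (map c s) b
  = has (fun t' => (c t' == b) &&
           (e y t && e t t' && e t' y || e t y && e t' t && e y t')) s.
Proof. by elim: s => //= t' s ->. Qed.

(** A triangle through y is found at whichever of its two other vertices comes first in [s], hence
    in either orientation. A digon is witnessed with t' = t. *)
Lemma badP (c : V -> bool) y s b :
  reflect (exists t t', [/\ t \in s, t' \in s, c t = b, c t' = b
                          & e y t && (e t y || e t t' && e t' y)])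
    (bad (map (link_of e y) s) (rows e s) (map c s) b).
Proof.
elim: s => [|x s IH] /=; first by constructor => -[t [t' []]].
rewrite bad2_rows; apply: (iffP orP) => [[/andP[/eqP cx /orP[/andP[yx xy]|]]|/IH]|].
- by exists x, x; rewrite mem_head yx xy.
- case/hasP=> t ts /andP[/eqP ct /orP[]/andP[/andP[a1 a2] a3]].
    by exists x, t; rewrite !inE eqxx ts orbT a1 a2 a3 orbT.
  by exists t, x; rewrite !inE eqxx ts orbT a1 a2 a3 orbT.
- by move=> [t [t' [ts t's ct ct' h]]]; exists t, t'; rewrite !inE ts t's !orbT.
move=> [t [t' []]]; rewrite !inE.
case/predU1P=> [->|ts] /predU1P[->|t's] ct ct' /andP[yt h].
- left; rewrite ct eqxx yt /=; move: h; rewrite irr_e orbF => -> //.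
- left; rewrite ct eqxx yt /=; case/orP: h => [->//|/andP[h1 h2]].
  by apply/orP; right; apply/hasP; exists t'; rewrite // ct' eqxx h1 h2.
- case/orP: h => [ty|/andP[h1 h2]].
    by right; apply/IH; exists t, t; rewrite ts yt ty.
  left; rewrite ct' eqxx /=.
  by apply/orP; right; apply/hasP; exists t; rewrite // ct eqxx h1 h2 yt !orbT.
- by right; apply/IH; exists t, t'; rewrite ts t's yt h.
Qed.

(** A monochromatic digon or triangle through the front vertex is rotated to start there, where
    [badP] applies; any other one lies in the tail. *)
Lemma proper_rows (c : V -> bool) s :
  reflect (good e c s) (proper (rows e s) (map c s)).
Proof.
elim: s => [|y s IH] /=; first by constructor.
apply: (iffP andP) => [[/badP nb /IH gs] x1 x2 x3|gys].
  rewrite !inE /mono => h1 h2 h3; apply/and4P=> -[/eqP c12 /eqP c13 a12].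
  have dig u v : u \in s -> v \in y :: s -> c u = c v -> e u v -> e v u -> False.
    move=> us; rewrite inE => /predU1P[->|vs] cuv uv vu.
      by case: nb; exists u, u; rewrite us vu uv cuv.
    by have := gs u v u us vs us; rewrite /mono cuv uv vu !eqxx.
  have tri u v : u \in s -> v \in s -> c u = c y -> c v = c y ->
      e y u -> e u v -> e v y -> False.
    move=> us vs cu cv yu uv vy.
    by case: nb; exists u, v; rewrite us vs cu cv yu uv vy orbT.
  case/orP=> [a21|/andP[a23 a31]].
    case/predU1P: h1 => [h1|h1]; last by apply: (dig x1 x2).
    case/predU1P: h2 => [h2|h2]; first by rewrite h1 h2 irr_e in a12.
    by apply: (dig x2 x1) => //; rewrite inE h1 eqxx.
  case/predU1P: h1 => h1; case/predU1P: h2 => h2; case/predU1P: h3 => h3; subst;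
    rewrite ?irr_e // in a12 a23 a31.
  - by apply: (tri x2 x3).
  - by apply: (tri x3 x1); rewrite -?c13.
  - by apply: (tri x1 x2); rewrite -?c12.
  - by have := gs x1 x2 x3 h1 h2 h3; rewrite /mono c12 -c13 c12 !eqxx a12 a23 a31 orbT.
split; last by apply/IH => x1 x2 x3 h1 h2 h3; apply: gys; rewrite inE ?h1 ?h2 ?h3 orbT.
apply/badP => -[t [t' [ts t's ct ct' /andP[yt h]]]].
have := gys y t t'; rewrite /mono !inE ts t's eqxx !orbT => /(_ isT isT isT).
by rewrite ct ct' eqxx yt h.
Qed.

Lemma colourings_rows (c : V -> bool) s :
  good e c s -> map c s \in colourings (rows e s).
Proof. by move=> gc; rewrite mem_colourings size_map size_rows eqxx; apply/proper_rows. Qed.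

Definition colour_of s (f : seq bool) (c : V -> bool) x :=
  if x \in s then nth false f (index x s) else c x.

Lemma map_colour_of s f c : uniq s -> size f = size s -> map (colour_of s f c) s = f.
Proof.
move=> us sf; apply: (@eq_from_nth _ false) => [|i]; rewrite size_map // => li.
case: s us sf li => // x0 s us sf li; rewrite (nth_map x0) // /colour_of mem_nth //.
by rewrite index_uniq.
Qed.

(** Below the diagonal the stored link is reversed; the diagonal value agrees with irreflexivity. *)
Definition get (m : lmatrix) (u v : nat) : link :=
  if u < v then nth (false, false) (nth [::] m u) (v - u.+1)
  else if v < u then let l := nth (false, false) (nth [::] m v) (u - v.+1) in (l.2, l.1)
  else (false, false).

(** The positions may come in any order, so they can encode an embedding and not just a subset. *)
Definition submatrix (m : lmatrix) : seq nat -> lmatrix :=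
  fix sub p := if p is i :: p' then [seq get m i j | j <- p'] :: sub p' else [::].

Lemma nth_rows x0 s u v : u < v -> v < size s ->
  nth (false, false) (nth [::] (rows e s) u) (v - u.+1)
  = link_of e (nth x0 s u) (nth x0 s v).
Proof.
elim: s u v => [|x s IH] [|u] [|v] //=; rewrite ltnS => uv lv; last exact: IH.
by rewrite subSS subn0 (nth_map x0).
Qed.

Lemma get_rows x0 s u v : u < size s -> v < size s ->
  get (rows e s) u v = link_of e (nth x0 s u) (nth x0 s v).
Proof.
rewrite /get => lu lv; case: ltngtP => [uv|vu|->].
- exact: nth_rows.
- by rewrite (nth_rows x0).
- by rewrite /link_of irr_e.
Qed.

Lemma submatrix_rows x0 s p : all (fun i => i < size s) p ->
  submatrix (rows e s) p = rows e (map (nth x0 s) p).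
Proof.
elim: p => //= i p IH /andP[li lp]; rewrite (IH lp) -map_comp.
by congr cons; apply/eq_in_map => j /(allP lp) lj; apply: get_rows.
Qed.

End Rows.

(** * Deleting an arc *)

Definition delarc (V : eqType) (e : rel V) (u v : V) : rel V :=
  fun x y => e x y && ((x, y) != (u, v)).

Fixpoint update (T : Type) (s : seq T) (i : nat) (g : T -> T) :=
  match s, i with
  | [::], _ => [::]
  | x :: s', 0 => g x :: s'
  | x :: s', i'.+1 => x :: update s' i' g
  end.

(** The first component of a link is the arc leaving the earlier vertex. It is cleared when the tail
    [u] is reached first, the second component when the head [v] is. *)
Fixpoint delete_arc (m : lmatrix) (u v : nat) : lmatrix :=
  match m, u, v with
  | row :: m', 0, v'.+1 => update row v' (fun l => (false, l.2)) :: m'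
  | row :: m', u'.+1, 0 => update row u' (fun l => (l.1, false)) :: m'
  | row :: m', u'.+1, v'.+1 => row :: delete_arc m' u' v'
  | _, _, _ => m
  end.

Lemma update_map (V : eqType) (T : Type) (h : V -> T) x0 (s : seq V) i g :
  uniq s -> i < size s ->
  update (map h s) i g = [seq if t == nth x0 s i then g (h t) else h t | t <- s].
Proof.
elim: s i => [|x s IH] [|i] //= /andP[xs us] li; rewrite ?eqxx.
  congr cons; apply/eq_in_map => t ts; rewrite ifN //.
  by apply: contraNneq xs => <-.
rewrite IH // ifN //; apply: contraNneq xs => ->; exact: mem_nth.
Qed.

Section DelArc.
Variables (V : eqType) (e : rel V).
Hypothesis irr_e : irreflexive e.

Lemma irr_delarc u v : irreflexive (delarc e u v).
Proof. by move=> x; rewrite /delarc irr_e. Qed.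

Lemma rows_delarc_notin u v s : (u \notin s) || (v \notin s) ->
  rows (delarc e u v) s = rows e s.
Proof.
elim: s => //= x s IH; rewrite !inE !negb_or => h.
rewrite IH; last by case/orP: h => /andP[_ ->]; rewrite ?orbT.
congr cons; apply/eq_in_map => t ts; rewrite /link_of /delarc !xpair_eqE.
have: ~~ ((x == u) && (t == v)) /\ ~~ ((t == u) && (x == v)).
  split; apply/negP => /andP[/eqP xu /eqP tv]; subst; move: h; by rewrite ts eqxx !andbF.
by case=> -> ->; rewrite !andbT.
Qed.

(** As [s] is duplicate-free, the pair occupies a single entry of the matrix, so one update realises
    the deletion. *)
Lemma delete_arc_rows x0 s u v : uniq s -> u < size s -> v < size s -> u != v ->
  delete_arc (rows e s) u v = rows (delarc e (nth x0 s u) (nth x0 s v)) s.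
Proof.
elim: s u v => [|x s IH] [|u] [|v] //= /andP[xs us].
- move=> _ lv _; rewrite rows_delarc_notin ?xs // (update_map _ x0) //.
  congr cons; apply/eq_in_map => t ts; rewrite /link_of /delarc !xpair_eqE eqxx /=.
  have -> : (t == x) = false by apply/negbTE; apply: contraNneq xs => <-.
  by case: eqP => _ /=; rewrite ?andbF ?andbT.
- move=> lu _ _; rewrite rows_delarc_notin ?xs ?orbT // (update_map _ x0) //.
  congr cons; apply/eq_in_map => t ts; rewrite /link_of /delarc !xpair_eqE eqxx /=.
  have -> : (t == x) = false by apply/negbTE; apply: contraNneq xs => <-.
  by case: eqP => _ /=; rewrite ?andbF ?andbT.
rewrite !ltnS eqSS => lu lv uv; rewrite IH //; congr cons.
apply/eq_in_map => t ts; rewrite /link_of /delarc !xpair_eqE.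
have nx i : i < size s -> (x == nth x0 s i) = false.
  by move=> li; apply/negbTE; apply: contraNneq xs => ->; apply: mem_nth.
by rewrite !nx // !andbF !andbT.
Qed.

End DelArc.

(* Labellings of the arc at positions [u], [v], normalised to colour it [true]. *)
Definition labels (m : lmatrix) (u v : nat) :=
  [seq cs <- colourings (delete_arc m u v) | nth false cs u && nth false cs v].

(** The candidate rows of a new vertex of colour [b]. They are built from the last link on, and a
    partial row that closes a monochromatic digon or triangle is never extended. *)
Fixpoint extensions (rels : seq link) (m : lmatrix) (cs : seq bool) (b : bool) :=
  match m, cs with
  | rt :: m', c :: cs' =>
    flatten [seq [seq r :: row | r <- rels &
                    ~~ ((c == b) && (r.1 && r.2 || bad2 r rt row cs' b))]
            | row <- extensions rels m' cs' b]
  | _, _ => [:: [::]]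
  end.

(** This completeness makes the search exhaustive: the row of an actual vertex outside the
    configuration is always among the candidates. *)
Lemma mem_extensions rels m cs b row :
  size row = size m -> size cs = size m -> {subset row <= rels} ->
  ~~ bad row m cs b -> row \in extensions rels m cs b.
Proof.
elim: m cs row => [|rt m IH] [|c cs] [|r row] //= [szr] [szc] sub.
rewrite negb_or => /andP[n1 n2]; apply/flatten_mapP; exists row.
  by apply: IH => // l lr; apply: sub; rewrite inE lr orbT.
by apply/mapP; exists r; rewrite ?mem_filter ?n1 ?sub ?mem_head.
Qed.

(** * The search *)

(* A step of the search: a configuration, the arc uv to consider, the recolourings
   f, and the reasons that exclude the one-vertex (1) and two-vertex (2)
   extensions: an arc without labelling, or an induced copy, given by an index
   and the positions of its vertices, of an earlier configuration. *)
Record node := Node {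
  node_matrix : seq (seq nat);
  node_arc : nat * nat;
  node_colourings : seq (seq nat);
  node_killers1 : seq (nat * nat);
  node_copies1 : seq (nat * seq nat);
  node_killers2 : seq (nat * nat);
  node_copies2 : seq (nat * seq nat) }.

(* 1 is an arc to, 2 an arc from, and 3 a digon with the later vertex. *)
Definition decode : seq (seq nat) -> lmatrix :=
  map (map (fun n => (odd n, 1 < n))).

(** An arc without labelling cannot occur in D, because a labelling of an arc of D restricts to
    every induced subdigraph containing it. The bound [jp.1 < i] makes the references between
    configurations well founded. *)
Definition kill (mats : seq lmatrix) (i : nat) (K : seq (nat * nat))
    (E : seq (nat * seq nat)) (m : lmatrix) :=
  if has (fun a => [&& a.1 < size m, a.2 < size m, (get m a.1 a.2).1
                     & labels m a.1 a.2 == [::]]) K then true else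
  has (fun jp => [&& jp.1 < i, uniq jp.2, all (fun x => x < size m) jp.2
                   & submatrix m jp.2 == nth [::] mats jp.1]) E.

(* Two new vertices y, y' are only needed for a cycle t -> y -> y' -> t through a
   vertex t on which [f] and the labelling [l] disagree. *)
Definition recoloured (row : seq link) (f l : seq bool) (b : bool) :=
  has (fun t => [&& t.1.2, t.2.1 == b & t.2.2 != b]) (zip row (zip f l)).

(** Rows are generated from [md] and [l], since outside vertices keep their colours from D - uv, and
    are tested against [m] and [f]. A bad row must be excluded by [k1]. Any other row matters only
    through a second vertex of the same colour; the condition on [(head (false, false) row').2]
    directs the arc from the first new vertex to the second. *)
Definition check_colouring rels (k1 k2 : pred lmatrix) (m md : lmatrix)
    (l f : seq bool) :=
  [&& size f == size m, proper m f &
    all (fun b => all (fun row =>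
      if bad row m f b then k1 (row :: m) else
      if ~~ recoloured row f l b then true else
      if k1 (row :: m) then true else
        all (fun row' =>
            if [&& (head (false, false) row').2, ~~ bad (behead row') m f b
                 & bad row' (row :: m) (b :: f) b]
            then k2 (row' :: row :: m) else true)
          (extensions rels (row :: md) (b :: l) b))
      (extensions rels md l b)) [:: true; false]].

(** A labelling that stays proper in the presence of uv serves as its own [f]; [recoloured] is then
    false, so only one-vertex extensions are inspected. *)
Definition check_node rels (mats : seq lmatrix) (i : nat) (nd : node) :=
  let m := nth [::] mats i in
  let: (u, v) := node_arc nd in
  let md := delete_arc m u v in
  let k1 := kill mats i (node_killers1 nd) (node_copies1 nd) in
  let k2 := kill mats i (node_killers2 nd) (node_copies2 nd) in
  [&& u < size m, v < size m, (get m u v).1 &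
    all (fun l => if proper m l then check_colouring rels k1 k2 m md l l
                  else has (fun f => check_colouring rels k1 k2 m md l (map odd f))
                         (node_colourings nd))
      (labels m u v)].

Definition check_nodes rels (base : seq lmatrix) (nds : seq node) :=
  let mats := base ++ [seq decode (node_matrix nd) | nd <- nds] in
  all (fun i => check_node rels mats (size base + i)
                  (nth (Node [::] (0, 0) [::] [::] [::] [::] [::]) nds i))
    (iota 0 (size nds)).

(** * Soundness of the search, for an arbitrary goal [G] *)

Section Soundness.
Variables (V : finType) (A : rel V) (x0 : V) (G : Prop).
Hypothesis irr_A : irreflexive A.
Hypothesis not_colourable : forall c, ~ (forall x y z, ~~ mono A c x y z).
Hypothesis arc_critical : forall u v, A u v ->
  exists c, forall x y z, ~~ mono (delarc A u v) c x y z.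

(** If u and v had different colours, uv would lie on no monochromatic digon or triangle, and c
    would colour D itself. Complementing c, if necessary, makes the common colour [true]. *)
Lemma arc_labelling u v : A u v ->
  exists c, [/\ forall x y z, ~~ mono (delarc A u v) c x y z, c u & c v].
Proof.
move=> auv; have [c gc] := arc_critical auv.
have cuv : c u = c v.
  apply/eqP/negPn/negP => ncuv; case: (not_colourable (c := c)) => x y z.
  apply: contra (gc x y z); rewrite /mono /delarc !xpair_eqE.
  case/and4P=> /eqP cxy /eqP cxz; rewrite cxy eqxx -cxy cxz eqxx /= => axy h.
  have no p q : c p = c q -> ~~ ((p == u) && (q == v)).
    by move=> cpq; apply: contraNN ncuv => /andP[/eqP <- /eqP <-]; rewrite cpq.
  by rewrite axy !no -?cxy -?cxz // !andbT; case/orP: h => [->//|->]; rewrite orbT.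
have [cu|cu] := boolP (c u); first by exists c; rewrite -cuv cu.
exists (fun x => ~~ c x); split; rewrite -?cuv // => x y z.
by rewrite /mono !(inj_eq negb_inj); apply: gc.
Qed.

Lemma labels_rows s u v (c : V -> bool) : uniq s -> u < size s -> v < size s ->
  u != v -> (forall x y z, ~~ mono (delarc A (nth x0 s u) (nth x0 s v)) c x y z) ->
  c (nth x0 s u) -> c (nth x0 s v) -> map c s \in labels (rows A s) u v.
Proof.
move=> us lu lv uv gc cu cv; rewrite mem_filter !(nth_map x0) // cu cv.
by rewrite (delete_arc_rows _ x0) //; apply: colourings_rows; [apply: irr_delarc|move=> *].
Qed.

(** A configuration may be refuted because it cannot occur in D, or because its occurrence proves
    the goal. *)
Definition refuted (m : lmatrix) := forall s, uniq s -> rows A s = m -> G.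

Lemma kill_sound mats i K E s : uniq s ->
  (forall j, j < i -> refuted (nth [::] mats j)) -> kill mats i K E (rows A s) -> G.
Proof.
move=> us ref; rewrite /kill size_rows; case: ifP => [/hasP[[u v] _]|_ /hasP[[j p] _]].
  move=> /= /and4P[lu lv]; rewrite (get_rows irr_A x0) //= => auv /eqP lab.
  have uv : u != v by apply: contraTneq auv => ->; rewrite irr_A.
  have [c [gc cu cv]] := arc_labelling auv.
  by have := labels_rows us lu lv uv gc cu cv; rewrite lab.
move=> /= /and4P[ji up lp /eqP sub]; apply: (ref j ji (map (nth x0 s) p)).
  rewrite map_inj_in_uniq // => a b /(allP lp) la /(allP lp) lb /eqP.
  by rewrite nth_uniq // => /eqP.
by rewrite -sub (submatrix_rows irr_A x0).
Qed.

Variable rels : seq link.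
Hypothesis link_rels : forall x y, x != y -> link_of A x y \in rels.

(** Since y lies outside [s], the deletion of uv leaves its links untouched; a bad row for c would
    give a monochromatic cycle in D - uv. *)
Lemma extension_mem (s : seq V) y (c : V -> bool) u v : y \notin s ->
  u \in s -> v \in s -> (forall x y z, ~~ mono (delarc A u v) c x y z) ->
  map (link_of A y) s \in extensions rels (rows (delarc A u v) s) (map c s) (c y).
Proof.
move=> ys us vs gc; have irr' : irreflexive (delarc A u v) by apply: irr_delarc.
have rowE : map (link_of A y) s = map (link_of (delarc A u v) y) s.
  apply/eq_in_map => t ts; rewrite /link_of /delarc !xpair_eqE.
  have -> : (y == u) = false by apply/negbTE; apply: contraNneq ys => ->.
  have -> : (y == v) = false by apply/negbTE; apply: contraNneq ys => ->.
  by rewrite andbF !andbT.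
apply: mem_extensions; rewrite ?size_map ?size_rows //.
  move=> l /mapP[t ts ->]; apply: link_rels.
  by apply: contraNneq ys => ->.
rewrite rowE; apply/(badP irr') => -[t [t' [ts t's ct ct' /andP[yt h]]]].
by have := gc y t t'; rewrite /mono ct ct' eqxx yt h.
Qed.

(** The recolouring [d] must have a monochromatic digon or triangle. If it lies in [s], then f is
    not proper. If one vertex is outside, that vertex has a bad row. If two vertices of a triangle
    are outside, [k1] or [k2] applies. If all vertices are outside, the cycle is already
    monochromatic for c in D - uv. *)
Lemma check_colouring_sound s u v (c : V -> bool) f (k1 k2 : pred lmatrix) :
  uniq s -> u \in s -> v \in s ->
  (forall x y z, ~~ mono (delarc A u v) c x y z) ->
  (forall s', uniq s' -> k1 (rows A s') -> G) ->
  (forall s', uniq s' -> k2 (rows A s') -> G) ->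
  check_colouring rels k1 k2 (rows A s) (rows (delarc A u v) s) (map c s) f -> G.
Proof.
move=> us uS vS gc k1G k2G /and3P[/eqP szf prf /allP chk].
rewrite size_rows in szf.
pose d := colour_of s f c.
have ds : map d s = f by apply: map_colour_of.
have dout y : y \notin s -> d y = c y by rewrite /d /colour_of => /negbTE ->.
have gd : good A d s by apply/(proper_rows irr_A); rewrite ds.
have chkb y : y \notin s ->
  let row := map (link_of A y) s in
  if bad row (rows A s) f (c y) then k1 (row :: rows A s) else
  if ~~ recoloured row f (map c s) (c y) then true else
  if k1 (row :: rows A s) then true else
    all (fun row' =>
           if [&& (head (false, false) row').2, ~~ bad (behead row') (rows A s) f (c y)
                & bad row' (row :: rows A s) (c y :: f) (c y)]
           then k2 (row' :: row :: rows A s) else true)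
      (extensions rels (row :: rows (delarc A u v) s) (c y :: map c s) (c y)).
  move=> ys /=; have /chk/allP : c y \in [:: true; false] by case: (c y).
  by move=> h; apply: h; apply: extension_mem.
(* An outside vertex with a bad row is settled by [k1], so from here on no outside vertex has
   one. *)
have [/existsP[y /andP[ys by_]]|nobad] := boolP [exists y, (y \notin s) &&
    bad (map (link_of A y) s) (rows A s) f (c y)].
  have := chkb y ys; rewrite /= by_ => /(k1G (y :: s)); apply.
  by rewrite /= ys.
have nbad y : y \notin s -> ~~ bad (map (link_of A y) s) (rows A s) f (c y).
  by move=> ys; apply: contraNN nobad => h; apply/existsP; exists y; rewrite ys.
(* A cycle with exactly one vertex outside [s] would make that vertex bad. *)
have one y t t' : y \notin s -> t \in s -> t' \in s -> d t = c y -> d t' = c y ->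
    A y t -> A t y || A t t' && A t' y -> False.
  move=> ys ts t's dt dt' yt h; have /negP := nbad y ys; apply; rewrite -ds.
  by apply/(badP irr_A); exists t, t'; rewrite yt h.
have del x y : (x \notin s) || (y \notin s) -> A x y -> delarc A u v x y.
  move=> h axy; rewrite /delarc axy xpair_eqE /=; apply/negP => /andP[/eqP xu /eqP yv].
  by move: h; rewrite xu yv uS vS.
have two t y y' : t \in s -> y \notin s -> y' \notin s -> d t = c y -> c y' = c y ->
    A t y -> A y y' -> A y' t -> G.
  move=> ts ys y's dt cy' ty yy' y't.
  (* Each arc of the triangle has an end outside [s], so it survives the deletion of uv. Had t the
     colour of y under c, the triangle would be monochromatic in D - uv; hence f has recoloured
     t. *)
  have ct : c t != c y.
    apply: contraNneq (gc t y y') => ct.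
    rewrite /mono ct cy' eqxx /=.
    by rewrite (del t y) ?(del y y') ?(del y' t) ?orbT // ?ys ?y's ?orbT.
  have := chkb y ys; rewrite /= (negbTE (nbad y ys)).
  have -> : recoloured (map (link_of A y) s) f (map c s) (c y).
    apply/hasP; exists (link_of A y t, (d t, c t)); last by rewrite /= ty dt eqxx ct.
    rewrite -ds -(map_id s) -!map_comp !zip_map; apply/mapP; exists t => //.
  case: ifP => [/(k1G (y :: s)) h _|_ /allP chk2]; first by apply: h; rewrite /= ys.
  have y'ny : y' != y by apply: contraTneq yy' => ->; rewrite irr_A.
  have ys' : y' \notin y :: s by rewrite inE negb_or y'ny.
  have rowE : map (link_of A y) s :: rows (delarc A u v) s = rows (delarc A u v) (y :: s).
    rewrite /=; congr cons; apply/eq_in_map => z zs; rewrite /link_of /delarc !xpair_eqE.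
    have -> : (y == u) = false by apply/negbTE; apply: contraNneq ys => ->.
    have -> : (y == v) = false by apply/negbTE; apply: contraNneq ys => ->.
    by rewrite andbF !andbT.
  have inS w : w \in s -> w \in y :: s by rewrite inE orbC => ->.
  have := extension_mem ys' (inS _ uS) (inS _ vS) gc.
  rewrite cy' -rowE => /chk2 h2; apply: (k2G (y' :: y :: s)).
    by rewrite /= ys ys'.
  move: h2; rewrite ifT //; apply/and3P; split; rewrite ?yy' //; first by rewrite -cy' nbad.
  rewrite -ds -(dout y ys); apply/(badP irr_A d y' (y :: s)).
  exists t, y; rewrite !inE ts eqxx orbT dt dout //; split=> //.
  by rewrite y't ty yy' orbT.
have three x y z : x \notin s -> y \notin s -> mono A d x y z -> (z \notin s) || A y x -> False.
  move=> xs ys /and4P[/eqP cxy /eqP cxz axy h] zs.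
  rewrite (dout x) // in cxz; rewrite (dout x) // (dout y) // in cxy.
  have [ayx|nayx] := boolP (A y x).
    by have := gc x y x; rewrite /mono cxy eqxx /= (del x y) ?(del y x) ?xs ?ys.
  rewrite (negbTE nayx) orbF in zs; rewrite (negbTE nayx) /= in h.
  case/andP: h => ayz azx; rewrite dout // in cxz.
  have := gc x y z; rewrite /mono -cxz cxy eqxx /=.
  by rewrite (del x y) ?(del y z) ?(del z x) ?xs ?ys ?zs ?orbT.
case: (boolP [exists x, exists y, exists z, mono A d x y z]) => [|nex]; last first.
  case: (not_colourable (c := d)) => x y z; apply: contraNN nex => h.
  by apply/existsP; exists x; apply/existsP; exists y; apply/existsP; exists z.
case/existsP=> x /existsP[y /existsP[z mxyz]].
have /and4P[/eqP cxy /eqP cxz axy h] := mxyz.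
have [ayx|nayx] := boolP (A y x).
  have [xs|xs] := boolP (x \in s); have [ys|ys] := boolP (y \in s).
  - by have := gd x y x xs ys xs; rewrite /mono cxy axy ayx !eqxx.
  - by case: (one y x x) => //; rewrite ?cxy ?dout // axy.
  - by case: (one x y y) => //; rewrite -?cxy ?dout // ayx.
  - by case: (three x y z) => //; rewrite ayx orbT.
rewrite (negbTE nayx) /= in h; case/andP: h => ayz azx.
(* Up to rotation, only the number of vertices outside [s] matters. *)
have [xs|xs] := boolP (x \in s); have [ys|ys] := boolP (y \in s);
  have [zs|zs] := boolP (z \in s).
- by have := gd x y z xs ys zs; rewrite mxyz.
- by case: (one z x y) => //; rewrite -?dout // -?cxz -?cxy // axy ayz orbT.
- by case: (one y z x) => //; rewrite -?dout // -?cxy -?cxz // azx axy orbT.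
- by apply: (two x y z) => //; rewrite -!dout // -?cxz.
- by case: (one x y z) => //; rewrite -?dout // ayz azx orbT.
- by apply: (two y z x) => //; rewrite -!dout // -?cxz -?cxy.
- by apply: (two z x y) => //; rewrite -!dout // -?cxy -?cxz.
- by case: (three x y z) => //; rewrite zs.
Qed.

Lemma check_node_sound mats i nd :
  (forall j, j < i -> refuted (nth [::] mats j)) -> check_node rels mats i nd ->
  refuted (nth [::] mats i).
Proof.
move=> ref + s us sm; rewrite /check_node -sm size_rows; case: (node_arc nd) => u v.
case/and4P=> lu lv; rewrite (get_rows irr_A x0) //= => auv /allP chk.
have uv : u != v by apply: contraTneq auv => ->; rewrite irr_A.
have [c [gc cu cv]] := arc_labelling auv.
have := chk _ (labels_rows us lu lv uv gc cu cv).
rewrite (delete_arc_rows _ x0) //.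
case: ifP => [_|_ /hasP[f _]]; apply: check_colouring_sound => //;
  rewrite ?mem_nth // => s' us'; exact: kill_sound.
Qed.

(** Strong induction on the position in [mats], as [kill] cites only smaller positions. *)
Lemma check_nodes_sound base nds : check_nodes rels base nds ->
  (forall m, m \in base -> refuted m) ->
  forall m, m \in [seq decode (node_matrix nd) | nd <- nds] -> refuted m.
Proof.
move=> /allP chk refb; set mats := base ++ [seq decode (node_matrix nd) | nd <- nds].
have main i : i < size mats -> refuted (nth [::] mats i).
  elim/ltn_ind: i => i IH li.
  have [ib|bi] := ltnP i (size base).
    by rewrite nth_cat ib; apply/refb/mem_nth.
  have lin : i - size base < size nds.
    by rewrite ltn_subLR // -(size_map (decode \o node_matrix)) -size_cat.
  have := chk (i - size base); rewrite mem_iota add0n lin subnKC // => /(_ isT).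
  by apply: check_node_sound => j ji; apply: IH => //; apply: ltn_trans ji li.
move=> m /(nthP [::])[i li <-].
have <- : nth [::] mats (size base + i) =
          nth [::] [seq decode (node_matrix nd) | nd <- nds] i.
  by rewrite nth_cat ltnNge leq_addr /= addKn.
by apply: main; rewrite size_cat ltn_add2l.
Qed.

End Soundness.

(** * The configurations *)

(** In the order of [eight], for the vertex orderings chosen in [eight_enum]. *)
Definition eight_matrices : seq lmatrix := map decode [::
  [:: [:: 3; 3]; [:: 3]; [::]];
  [:: [:: 1; 2; 3]; [:: 1; 3]; [:: 3]; [::]];
  [:: [:: 3; 1; 2; 3]; [:: 1; 1; 2]; [:: 1; 1]; [:: 1]; [::]];
  [:: [:: 1; 1; 2; 2]; [:: 3; 1; 1]; [:: 1; 1]; [:: 3]; [::]];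
  [:: [:: 1; 1; 2; 2; 2]; [:: 3; 1; 1; 1]; [:: 1; 1; 1]; [:: 1; 2]; [:: 1];
  [::]];
  [:: [:: 1; 1; 1; 2; 2]; [:: 1; 2; 1; 1]; [:: 1; 1; 1]; [:: 1; 1]; [:: 3];
  [::]];
  [:: [:: 1; 1; 1; 2; 2; 2]; [:: 1; 2; 1; 1; 1]; [:: 1; 1; 1; 1]; [:: 1; 1;
  1]; [:: 1; 2]; [:: 1]; [::]];
  [:: [:: 1; 1; 2; 1; 2; 2]; [:: 1; 1; 2; 1; 2]; [:: 1; 1; 2; 1]; [:: 1; 1;
  2]; [:: 1; 1]; [:: 1]; [::]]
  ].

(** Copies are cited by position in the list that begins with the eight matrices, so the first node
    has index 8. The last node is a single digon, where the search starts. *)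
Definition digon_nodes : seq node := [::
  Node [:: [:: 2; 2; 1]; [:: 2; 3]; [:: 3]; [::]] (2, 0) [::] [::] [::] [::]
    [::];
  Node [:: [:: 2; 1; 2; 1]; [:: 2; 1; 2]; [:: 2; 3]; [:: 3]; [::]] (3, 0)
    [::] [:: (0, 3)] [::] [::] [::];
  Node [:: [:: 1; 1; 1]; [:: 2; 3]; [:: 3]; [::]] (0, 1) [::] [::] [::] [::]
    [::];
  Node [:: [:: 2; 1; 2]; [:: 2; 3]; [:: 3]; [::]] (3, 0) [::] [:: (0, 2);
    (3, 0)] [:: (10, [:: 0; 2; 3; 4]); (2, [:: 4; 2; 1; 0; 3]); (9, [:: 0; 1;
    2; 3; 4]); (8, [:: 0; 2; 3; 4])] [::] [::];
  Node [:: [:: 2; 2; 2]; [:: 2; 3]; [:: 3]; [::]] (2, 0) [::] [::] [::] [::]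
    [::];
  Node [:: [:: 1; 2; 2]; [:: 2; 3]; [:: 3]; [::]] (2, 0) [::] [:: (4, 2)]
    [:: (10, [:: 0; 2; 3; 4])] [::] [::];
  Node [:: [:: 1; 1; 2]; [:: 2; 3]; [:: 3]; [::]] (0, 1) [::] [::] [::] [::]
    [::];
  Node [:: [:: 2; 1; 1]; [:: 2; 3]; [:: 3]; [::]] (1, 3) [:: [:: 0; 1; 1;
    0]] [:: (1, 0); (0, 2); (0, 4); (3, 0)] [:: (11, [:: 0; 2; 3; 4]); (14,
    [:: 0; 2; 3; 4]); (13, [:: 0; 2; 3; 4]); (12, [:: 0; 2; 3; 4])] [:: (1,
    3)] [:: (10, [:: 0; 3; 4; 5]); (14, [:: 0; 3; 4; 5])];
  Node [:: [:: 2; 3]; [:: 3]; [::]] (2, 1) [:: [:: 0; 0; 1]] [:: (0, 1); (1,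
    0)] [:: (15, [:: 0; 1; 2; 3]); (11, [:: 0; 1; 2; 3]); (1, [:: 0; 2; 1;
    3]); (8, [:: 0; 1; 2; 3]); (13, [:: 0; 1; 2; 3]); (12, [:: 0; 1; 2; 3])]
    [:: (0, 2); (1, 2)] [:: (10, [:: 0; 2; 3; 4]); (14, [:: 0; 2; 3; 4])];
  Node [:: [:: 2; 2; 2; 1]; [:: 2; 2; 1]; [:: 2; 2]; [:: 3]; [::]] (3, 0)
    [::] [::] [::] [::] [::];
  Node [:: [:: 2; 3; 2; 1]; [:: 2; 2; 1]; [:: 2; 2]; [:: 3]; [::]] (3, 0)
    [::] [::] [::] [::] [::];
  Node [:: [:: 2; 1; 2; 1; 2]; [:: 2; 2; 2; 1]; [:: 2; 1; 2]; [:: 2; 1]; [::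
    3]; [::]] (3, 0) [::] [::] [::] [::] [::];
  Node [:: [:: 2; 2; 1; 1]; [:: 2; 2; 1]; [:: 2; 1]; [:: 3]; [::]] (2, 4)
    [::] [::] [::] [::] [::];
  Node [:: [:: 2; 1; 1; 1; 2]; [:: 2; 2; 1; 1]; [:: 2; 2; 2]; [:: 2; 1]; [::
    2]; [::]] (0, 2) [::] [::] [::] [::] [::];
  Node [:: [:: 1; 1; 1; 1]; [:: 2; 2; 2]; [:: 2; 1]; [:: 2]; [::]] (0, 1)
    [::] [::] [::] [::] [::];
  Node [:: [:: 2; 2; 1; 2; 1]; [:: 2; 2; 1; 2]; [:: 2; 2; 1]; [:: 2; 2]; [::
    3]; [::]] (4, 0) [::] [:: (6, 4); (0, 3); (3, 6)] [:: (22, [:: 0; 2; 3; 4;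
    6]); (20, [:: 0; 1; 3; 5; 6]); (21, [:: 0; 1; 2; 3; 4; 6]); (19, [:: 0; 1;
    2; 3; 5; 6])] [::] [::];
  Node [:: [:: 1; 1; 1]; [:: 2; 2]; [:: 3]; [::]] (0, 1) [::] [::] [::] [::]
    [::];
  Node [:: [:: 2; 1; 2; 1; 1]; [:: 2; 2; 1; 2]; [:: 2; 2; 1]; [:: 2; 2]; [::
    3]; [::]] (5, 4) [:: [:: 1; 0; 1; 0; 1; 0]] [:: (1, 3); (0, 3); (0, 2);
    (1, 0); (2, 1); (4, 0); (5, 6); (0, 1); (3, 0); (0, 4); (6, 0)] [:: (20,
    [:: 1; 2; 0; 6; 5]); (17, [:: 2; 0; 4; 6; 5]); (17, [:: 0; 2; 4; 6; 5]);
    (24, [:: 1; 0; 5; 6]); (24, [:: 0; 4; 5; 6]); (22, [:: 0; 2; 3; 4; 6])]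
    [:: (4, 3)] [:: (24, [:: 0; 5; 6; 7])];
  Node [:: [:: 2; 1; 1; 2; 1]; [:: 2; 2; 1; 2]; [:: 2; 2; 1]; [:: 2; 2]; [::
    3]; [::]] (0, 3) [::] [:: (5, 6); (5, 0)] [:: (17, [:: 3; 1; 0; 5; 6])]
    [::] [::];
  Node [:: [:: 2; 2; 1; 2]; [:: 2; 2; 1]; [:: 2; 2]; [:: 3]; [::]] (4, 0)
    [::] [:: (2, 1); (0, 3); (4, 5); (0, 2)] [:: (24, [:: 0; 3; 4; 5]); (23,
    [:: 0; 1; 2; 3; 4; 5]); (17, [:: 0; 2; 3; 4; 5]); (18, [:: 0; 2; 3; 4;
    5]); (25, [:: 0; 1; 2; 3; 4; 5]); (26, [:: 0; 1; 2; 3; 4; 5]); (17, [:: 2;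
    0; 3; 4; 5])] [::] [::];
  Node [:: [:: 1; 2; 1; 1; 2]; [:: 2; 2; 1; 1]; [:: 2; 2; 1]; [:: 2; 2]; [::
    3]; [::]] (5, 4) [:: [:: 1; 0; 0; 1; 1; 0]; [:: 0; 1; 1; 0; 0; 1]] [:: (1,
    4); (0, 6); (1, 0); (3, 0); (0, 4); (4, 3); (2, 0); (4, 0); (0, 2)] [::
    (24, [:: 0; 4; 5; 6]); (20, [:: 2; 3; 0; 5; 6]); (20, [:: 2; 0; 3; 5; 6]);
    (24, [:: 2; 0; 5; 6]); (22, [:: 3; 0; 1; 6; 2]); (17, [:: 0; 3; 4; 5; 6])]
    [:: (6, 7)] [::];
  Node [:: [:: 1; 1; 1; 1; 2]; [:: 2; 2; 1; 1]; [:: 2; 2; 1]; [:: 2; 2]; [::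
    3]; [::]] (5, 0) [:: [:: 0; 1; 1; 0; 0; 1]; [:: 0; 1; 0; 0; 0; 1]] [:: (1,
    3); (0, 4); (4, 0); (0, 6); (1, 2); (2, 0); (6, 5)] [:: (24, [:: 0; 4; 5;
    6]); (20, [:: 2; 3; 0; 5; 6]); (17, [:: 3; 0; 4; 5; 6]); (17, [:: 0; 3; 4;
    5; 6]); (20, [:: 2; 0; 1; 6; 5]); (24, [:: 2; 0; 5; 6])] [:: (7, 5); (3,
    6)] [:: (24, [:: 0; 5; 6; 7])];
  Node [:: [:: 2; 1; 1; 1; 2]; [:: 1; 1; 2; 1]; [:: 2; 2; 1]; [:: 2; 2]; [::
    3]; [::]] (1, 3) [::] [:: (0, 6)] [:: (17, [:: 3; 0; 4; 5; 6]); (17, [::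
    3; 2; 0; 5; 6]); (16, [:: 0; 5; 6])] [::] [::];
  Node [:: [:: 2; 2; 2; 2; 1]; [:: 2; 2; 1; 2]; [:: 2; 1; 1]; [:: 2; 1]; [::
    3]; [::]] (2, 0) [::] [:: (0, 2)] [:: (20, [:: 0; 1; 4; 5; 6]); (20, [::
    3; 0; 4; 5; 6]); (16, [:: 6; 0; 5])] [::] [::];
  Node [:: [:: 2; 2; 1; 1]; [:: 2; 2; 1]; [:: 2; 2]; [:: 3]; [::]] (3, 1)
    [:: [:: 1; 1; 0; 0; 1]] [:: (0, 3); (1, 0); (0, 2); (0, 5); (4, 0); (2,
    0); (4, 5); (3, 1)] [:: (29, [:: 0; 1; 2; 3; 4; 5]); (28, [:: 0; 1; 2; 3;
    4; 5]); (27, [:: 2; 0; 3; 5; 4]); (27, [:: 0; 2; 3; 4; 5]); (24, [:: 1; 0;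
    4; 5]); (20, [:: 1; 2; 0; 4; 5]); (20, [:: 1; 0; 2; 4; 5])] [:: (6, 4);
    (0, 4); (0, 6); (2, 1); (1, 4); (2, 5)] [:: (31, [:: 0; 1; 2; 3; 5; 6]);
    (24, [:: 0; 4; 5; 6]); (30, [:: 0; 1; 3; 4; 5; 6])];
  Node [:: [:: 2; 3; 1; 2]; [:: 2; 2; 1]; [:: 2; 2]; [:: 3]; [::]] (3, 2)
    [::] [:: (5, 4); (1, 3); (0, 1)] [:: (20, [:: 5; 2; 0; 3; 1]); (18, [:: 1;
    0; 3; 5; 4]); (24, [:: 5; 0; 1; 3])] [::] [::];
  Node [:: [:: 2; 2; 2; 2]; [:: 2; 2; 1]; [:: 2; 2]; [:: 3]; [::]] (3, 0)
    [::] [::] [::] [::] [::];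
  Node [:: [:: 2; 1; 1; 2]; [:: 2; 2; 1]; [:: 2; 2]; [:: 3]; [::]] (0, 2)
    [::] [:: (5, 3); (4, 0); (5, 4)] [:: (27, [:: 2; 0; 3; 5; 4]); (27, [:: 0;
    2; 3; 4; 5]); (27, [:: 1; 2; 0; 4; 5]); (34, [:: 0; 2; 3; 4; 5])] [::]
    [::];
  Node [:: [:: 2; 2; 1]; [:: 2; 2]; [:: 3]; [::]] (2, 0) [::] [:: (0, 2)]
    [:: (24, [:: 0; 2; 3; 4]); (32, [:: 0; 1; 2; 3; 4]); (35, [:: 0; 1; 2; 3;
    4]); (27, [:: 0; 1; 2; 3; 4]); (33, [:: 0; 1; 2; 3; 4]); (16, [:: 3; 0;
    4])] [::] [::];
  Node [:: [:: 1; 2; 1]; [:: 2; 2]; [:: 3]; [::]] (0, 1) [::] [::] [:: (36,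
    [:: 0; 2; 3; 4]); (36, [:: 1; 0; 3; 4]); (16, [:: 0; 3; 4])] [::] [::];
  Node [:: [:: 2; 2; 1; 1]; [:: 2; 1; 1]; [:: 2; 2]; [:: 3]; [::]] (2, 1)
    [:: [:: 0; 0; 1; 0; 1]; [:: 0; 0; 1; 1; 0]] [:: (1, 0); (0, 1); (0, 3);
    (1, 4); (1, 5); (4, 3); (5, 3)] [:: (24, [:: 0; 3; 4; 5]); (5, [:: 3; 0;
    2; 1; 4; 5]); (37, [:: 0; 3; 4; 5]); (36, [:: 0; 3; 4; 5]); (37, [:: 0; 3;
    5; 4]); (36, [:: 0; 3; 5; 4]); (20, [:: 4; 1; 2; 3; 0]); (36, [:: 4; 1; 0;
    3]); (20, [:: 5; 1; 2; 3; 0]); (24, [:: 1; 0; 4; 5]); (16, [:: 4; 0; 5]);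
    (16, [:: 0; 4; 5]); (36, [:: 5; 1; 0; 3]); (16, [:: 5; 0; 4]); (16, [:: 0;
    5; 4])] [:: (0, 2)] [::];
  Node [:: [:: 3; 2; 1]; [:: 2; 2]; [:: 3]; [::]] (2, 3) [:: [:: 0; 1; 1;
    0]] [:: (3, 2); (1, 2); (3, 0); (4, 2)] [:: (37, [:: 0; 2; 4; 3]); (36,
    [:: 0; 2; 4; 3]); (36, [:: 1; 0; 3; 4]); (16, [:: 3; 0; 4]); (16, [:: 0;
    3; 4]); (37, [:: 1; 0; 3; 4]); (16, [:: 0; 4; 3])] [::] [::];
  Node [:: [:: 2; 1; 1]; [:: 2; 2]; [:: 3]; [::]] (3, 1) [:: [:: 1; 0; 0;
    1]] [:: (0, 2); (4, 0); (0, 4); (1, 0); (1, 4); (3, 2)] [:: (38, [:: 1; 0;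
    2; 3; 4]); (38, [:: 0; 1; 2; 3; 4]); (3, [:: 2; 0; 1; 3; 4]); (36, [:: 4;
    1; 0; 2]); (39, [:: 0; 2; 3; 4]); (36, [:: 0; 2; 4; 3]); (36, [:: 3; 1; 0;
    2]); (39, [:: 0; 2; 4; 3]); (3, [:: 1; 3; 4; 0; 2]); (24, [:: 1; 0; 3;
    4]); (16, [:: 3; 0; 4]); (36, [:: 0; 2; 3; 4]); (16, [:: 0; 3; 4]); (16,
    [:: 4; 0; 3])] [:: (4, 3); (2, 0)] [:: (36, [:: 0; 1; 4; 5]); (4, [:: 2;
    4; 5; 0; 3; 1]); (24, [:: 2; 0; 4; 5])];
  Node [:: [:: 2; 1; 1; 1; 1]; [:: 2; 1; 2; 1]; [:: 2; 2; 1]; [:: 1; 2]; [::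
    3]; [::]] (0, 4) [::] [:: (5, 6); (1, 3); (6, 5)] [:: (20, [:: 1; 2; 0; 5;
    6])] [::] [::];
  Node [:: [:: 2; 1; 2; 1]; [:: 2; 2; 1]; [:: 1; 2]; [:: 3]; [::]] (1, 0)
    [::] [:: (4, 5)] [:: (41, [:: 0; 1; 2; 3; 4; 5]); (36, [:: 2; 0; 4; 5])]
    [::] [::];
  Node [:: [:: 1; 1; 2; 1]; [:: 2; 2; 1]; [:: 1; 2]; [:: 3]; [::]] (0, 4)
    [::] [:: (0, 2); (1, 2); (2, 0); (5, 4)] [:: (22, [:: 0; 2; 1; 4; 3]);
    (42, [:: 2; 1; 0; 4; 5]); (36, [:: 1; 0; 4; 5]); (42, [:: 0; 3; 1; 5; 4])]
    [::] [::];
  Node [:: [:: 2; 2; 1]; [:: 1; 2]; [:: 3]; [::]] (1, 2) [::] [:: (3, 4)]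
    [:: (43, [:: 0; 1; 2; 3; 4]); (36, [:: 1; 0; 3; 4]); (16, [:: 0; 3; 4]);
    (42, [:: 0; 1; 2; 3; 4]); (36, [:: 2; 0; 4; 3])] [::] [::];
  Node [:: [:: 1; 2]; [:: 3]; [::]] (2, 1) [:: [:: 0; 0; 1]] [:: (1, 2)] [::
    (44, [:: 1; 0; 3; 2]); (16, [:: 3; 0; 2]); (36, [:: 1; 0; 3; 2]); (16, [::
    0; 3; 2]); (16, [:: 0; 2; 3]); (44, [:: 0; 1; 2; 3]); (37, [:: 1; 0; 3;
    2])] [::] [::];
  Node [:: [:: 3]; [::]] (1, 0) [:: [:: 1; 0]] [::] [:: (16, [:: 1; 0; 2]);
    (16, [:: 0; 1; 2]); (0, [:: 0; 1; 2]); (45, [:: 0; 1; 2]); (16, [:: 0; 2;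
    1])] [::] [:: (40, [:: 0; 1; 2; 3]); (45, [:: 0; 3; 2]); (16, [:: 3; 0;
    2])]
  ].

(** Again numbered from 8; the last node is the directed triangle. *)
Definition triangle_nodes : seq node := [::
  Node [:: [:: 2; 2; 2; 2]; [:: 2; 1; 2]; [:: 2; 2]; [:: 2]; [::]] (4, 0)
    [::] [::] [::] [::] [::];
  Node [:: [:: 2; 1; 2; 2; 1]; [:: 2; 1; 2; 2]; [:: 2; 2; 1]; [:: 2; 1]; [::
    2]; [::]] (4, 0) [::] [::] [::] [::] [::];
  Node [:: [:: 2; 1; 2; 2; 2]; [:: 2; 2; 1; 2]; [:: 1; 2; 2]; [:: 2; 1]; [::
    2]; [::]] (5, 0) [::] [::] [::] [::] [::];
  Node [:: [:: 2; 1; 1; 2; 2; 1]; [:: 2; 2; 2; 1; 2]; [:: 2; 1; 2; 2]; [::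
    2; 2; 1]; [:: 2; 1]; [:: 2]; [::]] (6, 5) [:: [:: 1; 0; 0; 1; 1; 1; 0];
    [:: 1; 0; 0; 0; 1; 1; 0]; [:: 1; 0; 1; 1; 0; 1; 0]; [:: 1; 0; 1; 0; 0; 1;
    0]] [:: (1, 7); (5, 1); (0, 1); (1, 0); (0, 7); (1, 3); (5, 7); (7, 0);
    (7, 3); (3, 2); (5, 2); (6, 3); (6, 5)] [:: (8, [:: 1; 2; 5; 6; 0]); (10,
    [:: 2; 5; 6; 3; 7; 0]); (9, [:: 5; 3; 1; 0; 6; 7]); (10, [:: 0; 1; 5; 2;
    3; 6]); (9, [:: 0; 3; 1; 5; 6; 7]); (8, [:: 0; 1; 5; 3; 6]); (8, [:: 2; 0;
    7; 4; 5]); (10, [:: 1; 2; 3; 5; 6; 0]); (9, [:: 0; 1; 2; 7; 5; 6]); (8,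
    [:: 2; 3; 4; 5; 0]); (8, [:: 4; 0; 1; 5; 6]); (8, [:: 3; 0; 4; 1; 6]); (9,
    [:: 3; 1; 5; 0; 6; 2]); (9, [:: 0; 1; 5; 3; 6; 2]); (8, [:: 0; 2; 3; 6;
    7]); (10, [:: 0; 1; 2; 6; 7; 5]); (8, [:: 0; 3; 4; 5; 6]); (9, [:: 1; 2;
    4; 0; 5; 3]); (9, [:: 0; 2; 4; 1; 5; 3]); (8, [:: 0; 1; 2; 4; 5]); (8, [::
    3; 4; 6; 7; 0])] [:: (7, 1)] [:: (8, [:: 3; 4; 5; 6; 0]); (8, [:: 4; 0; 1;
    2; 7])];
  Node [:: [:: 2; 2; 2; 1; 2]; [:: 2; 1; 2; 2]; [:: 2; 2; 1]; [:: 2; 1]; [::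
    2]; [::]] (2, 0) [::] [:: (4, 1)] [:: (8, [:: 2; 3; 5; 6; 0]); (11, [:: 0;
    1; 2; 3; 4; 5; 6]); (9, [:: 0; 2; 3; 4; 5; 6]); (9, [:: 1; 3; 0; 6; 4;
    5]); (10, [:: 0; 1; 2; 4; 5; 6]); (8, [:: 0; 1; 2; 5; 6])] [::] [::];
  Node [:: [:: 2; 1; 1; 2; 2]; [:: 2; 2; 1; 1]; [:: 2; 2; 2]; [:: 2; 1]; [::
    2]; [::]] (4, 2) [::] [::] [::] [::] [::];
  Node [:: [:: 2; 2; 2; 1; 1]; [:: 2; 1; 2; 2]; [:: 2; 2; 1]; [:: 2; 1]; [::
    2]; [::]] (2, 0) [::] [:: (0, 6)] [:: (8, [:: 2; 3; 5; 6; 0]); (8, [:: 6;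
    0; 1; 3; 4]); (12, [:: 2; 6; 0; 5; 1; 3]); (9, [:: 4; 2; 3; 0; 5; 6]); (9,
    [:: 6; 3; 0; 1; 4; 5]); (13, [:: 0; 1; 2; 3; 5; 6]); (10, [:: 0; 2; 3; 6;
    4; 5])] [::] [::];
  Node [:: [:: 2; 1; 2; 1; 2]; [:: 2; 1; 2; 2]; [:: 2; 2; 1]; [:: 2; 1]; [::
    2]; [::]] (5, 4) [:: [:: 0; 0; 1; 1; 1; 0]; [:: 0; 1; 1; 0; 1; 0]] [::]
    [:: (8, [:: 3; 1; 4; 5; 0]); (10, [:: 3; 5; 6; 1; 4; 0]); (10, [:: 1; 4;
    5; 2; 6; 0]); (7, [:: 0; 4; 6; 1; 5; 3; 2]); (13, [:: 1; 2; 3; 5; 0; 4]);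
    (13, [:: 0; 2; 3; 5; 1; 4]); (9, [:: 6; 3; 1; 0; 4; 5]); (10, [:: 0; 1; 6;
    2; 3; 4]); (9, [:: 4; 2; 3; 0; 5; 6]); (9, [:: 0; 3; 4; 2; 5; 1]); (10,
    [:: 0; 3; 4; 1; 2; 5]); (9, [:: 0; 2; 3; 4; 5; 6]); (8, [:: 0; 2; 3; 4;
    5]); (9, [:: 0; 2; 5; 1; 6; 3]); (13, [:: 2; 3; 1; 4; 0; 6]); (13, [:: 0;
    3; 1; 4; 2; 6]); (10, [:: 0; 2; 5; 3; 1; 6]); (10, [:: 3; 1; 2; 4; 5; 0]);
    (9, [:: 0; 3; 1; 6; 4; 5]); (10, [:: 1; 2; 3; 6; 4; 0]); (12, [:: 3; 1; 0;
    5; 6; 4]); (8, [:: 0; 1; 2; 5; 6]); (10, [:: 0; 2; 3; 6; 4; 5]); (10, [::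
    0; 3; 1; 5; 6; 4]); (8, [:: 2; 3; 5; 6; 0]); (9, [:: 0; 1; 6; 3; 4; 2]);
    (9, [:: 3; 1; 6; 0; 4; 2]); (12, [:: 2; 3; 0; 6; 4; 5]); (8, [:: 0; 1; 6;
    3; 4]); (10, [:: 0; 1; 2; 4; 5; 6]); (8, [:: 1; 2; 6; 4; 0]); (13, [:: 3;
    1; 2; 6; 0; 5]); (13, [:: 0; 1; 2; 6; 3; 5]); (10, [:: 2; 3; 1; 5; 6; 0]);
    (12, [:: 1; 2; 0; 4; 5; 6])] [:: (1, 2)] [:: (8, [:: 2; 3; 7; 5; 0]); (8,
    [:: 2; 0; 1; 7; 5])];
  Node [:: [:: 2; 1; 2; 1; 1]; [:: 2; 1; 2; 2]; [:: 2; 2; 1]; [:: 2; 1]; [::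
    2]; [::]] (5, 1) [:: [:: 1; 0; 0; 1; 0; 1]] [:: (1, 3); (4, 0)] [:: (8,
    [:: 3; 1; 4; 5; 0]); (12, [:: 3; 4; 0; 1; 2; 5]); (13, [:: 1; 2; 3; 5; 0;
    4]); (13, [:: 0; 2; 3; 5; 1; 4]); (9, [:: 4; 2; 3; 0; 5; 6]); (9, [:: 0;
    2; 3; 4; 5; 6]); (14, [:: 2; 3; 5; 6; 1; 0]); (14, [:: 3; 0; 1; 4; 2; 6]);
    (10, [:: 0; 2; 3; 6; 4; 5]); (9, [:: 0; 3; 4; 2; 5; 1]); (10, [:: 0; 3; 4;
    1; 2; 5]); (8, [:: 0; 2; 3; 4; 5]); (8, [:: 2; 3; 5; 6; 0]); (10, [:: 2;
    6; 4; 3; 5; 0]); (10, [:: 6; 3; 5; 4; 0; 1]); (14, [:: 2; 6; 0; 5; 1; 4]);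
    (12, [:: 0; 3; 4; 2; 5; 1]); (13, [:: 6; 4; 0; 2; 3; 1]); (8, [:: 6; 0; 3;
    1; 4]); (14, [:: 1; 2; 0; 4; 5; 6])] [::] [::];
  Node [:: [:: 1; 2; 1; 1; 2]; [:: 2; 1; 2; 2]; [:: 2; 2; 1]; [:: 2; 1]; [::
    2]; [::]] (5, 1) [::] [::] [:: (12, [:: 4; 2; 1; 0; 3; 5]); (8, [:: 4; 0;
    2; 5; 1]); (14, [:: 0; 2; 3; 4; 5; 6]); (13, [:: 2; 6; 4; 0; 5; 1]); (9,
    [:: 2; 6; 0; 1; 3; 4]); (8, [:: 0; 2; 3; 4; 5])] [::] [::];
  Node [:: [:: 2; 1; 2; 2]; [:: 2; 2; 1]; [:: 2; 1]; [:: 2]; [::]] (3, 2)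
    [:: [:: 0; 0; 1; 0; 1]] [::] [:: (10, [:: 1; 5; 3; 2; 4; 0]); (15, [:: 1;
    5; 3; 4; 0; 2]); (13, [:: 5; 3; 1; 4; 0; 2]); (14, [:: 0; 1; 2; 3; 4; 5]);
    (17, [:: 0; 1; 2; 3; 4; 5]); (16, [:: 5; 3; 1; 2; 4; 0]); (13, [:: 0; 3;
    1; 4; 5; 2]); (12, [:: 0; 1; 2; 3; 4; 5]); (8, [:: 0; 1; 2; 3; 4]); (8,
    [:: 1; 2; 4; 5; 0]); (16, [:: 0; 1; 2; 3; 4; 5]); (12, [:: 1; 2; 0; 5; 3;
    4]); (15, [:: 0; 1; 2; 3; 4; 5])] [::] [:: (8, [:: 2; 3; 5; 6; 0]); (8,
    [:: 2; 0; 6; 3; 1]); (8, [:: 2; 0; 1; 5; 6])];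
  Node [:: [:: 2; 2; 2; 1; 2]; [:: 2; 1; 2; 1]; [:: 2; 2; 1]; [:: 2; 1]; [::
    2]; [::]] (5, 4) [:: [:: 0; 0; 1; 1; 1; 0]; [:: 0; 1; 0; 1; 1; 0]; [:: 0;
    0; 0; 1; 1; 0]; [:: 0; 1; 1; 0; 1; 0]; [:: 0; 0; 1; 0; 1; 0]; [:: 0; 1; 0;
    0; 1; 0]] [:: (0, 1)] [:: (18, [:: 1; 4; 0; 2; 3]); (18, [:: 4; 0; 1; 2;
    5]); (18, [:: 3; 0; 1; 4; 5]); (6, [:: 5; 2; 4; 3; 0; 6; 1]); (18, [:: 0;
    1; 6; 2; 5]); (8, [:: 1; 0; 6; 2; 3]); (8, [:: 1; 0; 6; 3; 4]); (8, [:: 1;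
    0; 6; 4; 2]); (18, [:: 0; 3; 4; 5; 1]); (18, [:: 0; 2; 3; 5; 1]); (8, [::
    0; 2; 3; 4; 5]); (18, [:: 1; 2; 0; 3; 4]); (18, [:: 2; 0; 1; 3; 5]); (18,
    [:: 0; 1; 6; 3; 5]); (18, [:: 0; 4; 2; 5; 1])] [:: (0, 2)] [::];
  Node [:: [:: 2; 1; 2; 1]; [:: 2; 2; 1]; [:: 2; 1]; [:: 2]; [::]] (4, 3)
    [:: [:: 0; 1; 1; 0; 1]; [:: 1; 0; 1; 0; 1]; [:: 0; 0; 1; 0; 1]; [:: 1; 1;
    0; 0; 1]; [:: 0; 1; 0; 0; 1]; [:: 1; 0; 0; 0; 1]] [::] [:: (18, [:: 5; 2;
    4; 0; 1]); (18, [:: 3; 1; 2; 4; 0]); (19, [:: 5; 1; 2; 3; 4; 0]); (18, [::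
    3; 0; 5; 1; 4]); (18, [:: 2; 0; 5; 3; 4]); (19, [:: 0; 1; 2; 3; 4; 5]);
    (8, [:: 5; 1; 2; 3; 0]); (8, [:: 0; 1; 2; 3; 4]); (18, [:: 0; 1; 2; 4;
    5]); (18, [:: 0; 2; 3; 4; 5]); (18, [:: 0; 3; 1; 4; 5]); (18, [:: 5; 3; 4;
    0; 2]); (18, [:: 1; 2; 3; 4; 0]); (18, [:: 1; 0; 5; 2; 4]); (18, [:: 5; 1;
    4; 0; 3])] [::] [:: (8, [:: 6; 2; 3; 4; 0]); (18, [:: 4; 1; 3; 5; 0]); (8,
    [:: 6; 0; 4; 2; 1]); (18, [:: 2; 0; 6; 1; 5]); (18, [:: 6; 4; 5; 0; 1]);
    (18, [:: 2; 1; 4; 5; 0]); (18, [:: 2; 5; 6; 0; 1]); (19, [:: 2; 0; 1; 5;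
    6; 3]); (18, [:: 0; 1; 5; 6; 3]); (18, [:: 3; 1; 2; 5; 0]); (18, [:: 6; 2;
    5; 0; 1]); (18, [:: 3; 0; 6; 1; 5]); (8, [:: 6; 0; 2; 3; 1]); (18, [:: 3;
    5; 6; 0; 1]); (18, [:: 0; 1; 5; 6; 2]); (8, [:: 6; 0; 3; 4; 1]); (18, [::
    2; 0; 6; 3; 5]); (18, [:: 4; 0; 6; 1; 5]); (18, [:: 6; 3; 5; 0; 1]); (18,
    [:: 4; 2; 3; 5; 0])];
  Node [:: [:: 2; 1; 2; 2]; [:: 2; 1; 1]; [:: 2; 2]; [:: 2]; [::]] (4, 3)
    [::] [::] [:: (18, [:: 3; 5; 2; 0; 4]); (8, [:: 1; 0; 4; 5; 2]); (20, [::
    0; 1; 5; 2; 3]); (18, [:: 0; 1; 5; 2; 3]); (18, [:: 1; 0; 3; 4; 2])] [::]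
    [::];
  Node [:: [:: 2; 1; 1; 2]; [:: 2; 2; 1]; [:: 2; 1]; [:: 2]; [::]] (4, 3)
    [:: [:: 0; 1; 1; 1; 0]; [:: 0; 0; 1; 1; 0]; [:: 0; 1; 0; 0; 1]] [::] [::
    (18, [:: 4; 5; 2; 0; 1]); (18, [:: 5; 0; 1; 2; 3]); (18, [:: 0; 3; 4; 1;
    2]); (21, [:: 2; 4; 5; 3; 0]); (21, [:: 0; 1; 2; 3; 4]); (18, [:: 0; 1; 5;
    2; 4]); (18, [:: 1; 2; 3; 0; 5]); (21, [:: 3; 1; 2; 4; 0]); (21, [:: 1; 2;
    4; 0; 5]); (21, [:: 0; 2; 4; 1; 5]); (18, [:: 2; 0; 5; 3; 4]); (21, [:: 0;
    5; 3; 4; 1]); (18, [:: 0; 2; 3; 4; 5]); (18, [:: 0; 4; 1; 5; 3]); (18, [::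
    3; 0; 2; 4; 1])] [::] [::];
  Node [:: [:: 2; 2; 1]; [:: 2; 1]; [:: 2]; [::]] (1, 0) [::] [::] [:: (18,
    [:: 4; 2; 3; 0; 1]); (20, [:: 0; 1; 2; 3; 4]); (18, [:: 0; 1; 2; 3; 4]);
    (22, [:: 0; 1; 2; 3; 4])] [::] [::];
  Node [:: [:: 2; 1]; [:: 2]; [::]] (2, 1) [:: [:: 1; 1; 0]] [::] [:: (23,
    [:: 2; 0; 3; 1]); (23, [:: 0; 3; 1; 2]); (23, [:: 0; 2; 3; 1]); (23, [::
    1; 0; 2; 3]); (23, [:: 0; 1; 2; 3])] [::] [:: (23, [:: 2; 3; 0; 1]); (23,
    [:: 1; 2; 3; 0]); (23, [:: 1; 3; 4; 0])]
  ].

Definition links3 : seq link := [:: (true, false); (false, true); (true, true)].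
Definition links2 : seq link := [:: (true, false); (false, true)].

Lemma digon_nodes_ok : check_nodes links3 eight_matrices digon_nodes.
Proof. by lazy. Qed.

Lemma triangle_nodes_ok : check_nodes links2 eight_matrices triangle_nodes.
Proof. by lazy. Qed.

(** * Short cycles *)

(** In a directed cycle of length at least 4, a chord xz or yt among four consecutive vertices
    either shortcuts the cycle or closes a triangle. Induction on the length then leaves only loops,
    digons and triangles. *)
Lemma acyclic_of_chords (T : eqType) (r : rel T) :
  (forall x y z t, uniq [:: x; y; z; t] -> r x y -> r y z -> r z t ->
     [|| r x z, r z x, r y t | r t y]) ->
  (forall x, ~~ r x x) -> (forall x y, r x y -> ~~ r y x) ->
  (forall x y z, r x y -> r y z -> ~~ r z x) -> acyclic r.
Proof.
move=> chord no1 no2 no3 [s []].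
have [n] := ubnP (size s); elim: n s => // n IH [|x [|y [|z [|t s]]]] //= sz _ us.
- by rewrite (negbTE (no1 x)).
- by case/and3P=> /no2/negbTE->.
- by case/and4P=> xy yz zx _; rewrite (negbTE (no3 _ _ _ xy yz)) in zx.
case/and4P=> xy yz zt pt; rewrite ltnS in sz.
have ux : uniq [:: x; y; z; t].
  by have : uniq ([:: x; y; z; t] ++ s) := us; rewrite cat_uniq => /andP[].
case/or4P: (chord x y z t ux xy yz zt) => h.
- apply: (IH (x :: z :: t :: s)) => //=; last by rewrite h zt pt.
  by move: us; rewrite !inE !negb_or => /and4P[/and4P[_ -> -> ->] _ -> ->].
- by have := no3 _ _ _ xy yz; rewrite h.
- apply: (IH (x :: y :: t :: s)) => //=; last by rewrite xy h pt.
  by move: us; rewrite !inE !negb_or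
    => /and4P[/and4P[-> _ -> ->] /and3P[_ -> ->] _ ->].
- by have := no3 _ _ _ yz zt; rewrite h.
Qed.

(** The ends of a chord lie on the cycle and so in the same colour class, which therefore inherits
    the chord condition. *)
Lemma good_acyclic (V : finType) (e : rel V) (c : V -> bool) k :
  irreflexive e ->
  (forall x y z t, uniq [:: x; y; z; t] -> [|| e x z, e z x, e y t | e t y]) ->
  (forall x y z, ~~ mono e c x y z) ->
  acyclic (fun x y => [&& c x == k, c y == k & e x y]).
Proof.
move=> irr chord gc; apply: acyclic_of_chords => [x y z t||x y|x y z].
- move=> /chord h /and3P[-> -> _] /and3P[_ -> _] /and3P[_ -> _] //.
- by move=> x; rewrite irr !andbF.
- move=> /and3P[/eqP cx /eqP cy xy]; rewrite cx cy eqxx /=; apply/negP => yx.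
  by have := gc x y x; rewrite /mono cx cy xy yx !eqxx.
move=> /and3P[/eqP cx /eqP cy xy] /and3P[_ /eqP cz yz].
rewrite cx cz eqxx /=; apply/negP => zx.
by have := gc x y z; rewrite /mono cx cy cz xy yz zx eqxx orbT.
Qed.

Lemma acyclic_sub (T : eqType) (r r' : rel T) : subrel r r' -> acyclic r' -> acyclic r.
Proof. by move=> rr' ac [s [s0 us cs]]; apply: ac; exists s; rewrite (sub_cycle rr'). Qed.

Lemma dicolourable_good (V : finType) (e : rel V) (S : {set V}) : irreflexive e ->
  dicolourable2 S e -> exists c, good e c (enum S).
Proof.
move=> irr [c ac]; exists c => x y z; rewrite !mem_enum => xS yS zS.
apply/and4P => -[/eqP cxy /eqP cxz xy h].
have ne p q : e p q -> p != q by apply: contraTneq => ->; rewrite irr.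
have [yx|nyx] := boolP (e y x).
  apply: (ac (c x)); exists [:: x; y]; rewrite /= !inE xS yS !cxy !eqxx xy yx.
  by rewrite (ne _ _ xy).
rewrite (negbTE nyx) in h; case/andP: h => yz zx.
apply: (ac (c x)); exists [:: x; y; z].
rewrite /= !inE xS yS zS -cxz -!cxy !eqxx xy yz zx.
by rewrite negb_or (ne _ _ xy) (ne _ _ yz) eq_sym (ne _ _ zx).
Qed.

(** Applied to an arc uv that a proper subdigraph misses, either removed itself or incident to a
    removed vertex. Criticality thus reduces to the deletion of single arcs. *)
Lemma good_dicolourable (V : finType) (A B : rel V) (S : {set V}) u v c :
  irreflexive A -> semicomplete A ->
  (forall x y z, ~~ mono (delarc A u v) c x y z) ->
  (forall x y, x \in S -> y \in S -> B x y -> delarc A u v x y) ->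
  dicolourable2 S B.
Proof.
move=> irr sc gc sub; exists c => k.
apply: (acyclic_sub (r' := fun x y => [&& c x == k, c y == k & delarc A u v x y])).
  by move=> x y /and5P[xS yS -> ->] /(sub x y xS yS).
apply: good_acyclic gc; first exact: irr_delarc.
(* Only the pair {u, v} can be non-adjacent, and it is at most one of the diagonals. *)
move=> x y z t; rewrite /= !inE !negb_or => /and4P[/and3P[xy xz xt] /andP[yz yt] zt _].
have diag p q : p != q -> (delarc A u v p q || delarc A u v q p)
    || ((p == u) && (q == v) || (p == v) && (q == u)).
  move=> /sc; rewrite /delarc !xpair_eqE.
  case: (A p q); case: (A q p); rewrite //= ?orbF;
  by case: (p == u); case: (q == v); case: (p == v); case: (q == u).
have := diag x z xz; have := diag y t yt.
case: (delarc A u v x z) => //; case: (delarc A u v z x) => //.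
case: (delarc A u v y t) => //; case: (delarc A u v t y) => //= h1 h2.
by case/orP: h1 => /andP[/eqP h1 /eqP h1']; case/orP: h2 => /andP[/eqP h2 /eqP h2'];
  subst; rewrite eqxx in xy xt yz zt.
Qed.

(** * The eight digraphs *)

Section RowsMap.
Variables (U V : eqType).

Lemma eq_rows (e e' : rel U) s : e =2 e' -> rows e s = rows e' s.
Proof.
move=> ee'; elim: s => //= x s ->; congr cons.
by apply: eq_map => y; rewrite /link_of !ee'.
Qed.

Lemma rows_map (e : rel V) (g : U -> V) s :
  rows e (map g s) = rows (fun x y => e (g x) (g y)) s.
Proof. by elim: s => //= x s ->; rewrite -map_comp. Qed.

End RowsMap.

(** Up to permutation, this list is the isomorphism invariant that separates the eight digraphs. *)
Definition degrees (T : Type) (e : rel T) (s : seq T) :=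
  [seq (count (e x) s, count (e^~ x) s) | x <- s].

Lemma degrees_map (U V : Type) (e : rel V) (g : U -> V) s :
  degrees e (map g s) = degrees (fun x y => e (g x) (g y)) s.
Proof.
by rewrite /degrees -map_comp; apply: eq_map => x /=; rewrite !count_map.
Qed.

Lemma eq_in_degrees (T : eqType) (e e' : rel T) s :
  {in s &, e =2 e'} -> degrees e s = degrees e' s.
Proof.
move=> ee'; apply/eq_in_map => x xs.
by congr pair; apply: eq_in_count => y ys; apply: ee'.
Qed.

Lemma perm_degrees (T : eqType) (e : rel T) s t :
  perm_eq s t -> perm_eq (degrees e s) (degrees e t).
Proof.
move=> st; rewrite /degrees (eq_map (g := fun x => (count (e x) t, count (e^~ x) t))).
  exact: perm_map.
by move=> x; rewrite !(seq.permP st).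
Qed.

Definition matrix_degrees (m : lmatrix) :=
  degrees (fun i j => (get m i j).1) (iota 0 (size m)).

Lemma degrees_rows (T : eqType) (e : rel T) s : irreflexive e ->
  degrees e s = matrix_degrees (rows e s).
Proof.
case: s => // x0 s' irr; set s := x0 :: s'.
rewrite /matrix_degrees size_rows -{1}(mkseq_nth x0 s) /mkseq degrees_map.
by apply: eq_in_degrees => i j; rewrite !mem_iota => li lj; rewrite (get_rows irr x0).
Qed.

(** The orders are 3, 4, 5, 5, 6, 6, 7, 7; two digraphs of equal order differ in their lists of out-
    and in-degrees. *)
Lemma eight_matrices_nonisomorphic :
  all (fun i => all (fun j => (i == j) ||
      ~~ perm_eq (matrix_degrees (nth [::] eight_matrices i))
                 (matrix_degrees (nth [::] eight_matrices j)))
    (iota 0 8)) (iota 0 8).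
Proof. by lazy. Qed.

Lemma eight_matrices_critical :
  all (fun m => [&& 1 < size m, all (all (fun l => l.1 || l.2)) m,
                    colourings m == [::] &
        all (fun u => all (fun v => (get m u v).1 ==> (labels m u v != [::]))
          (iota 0 (size m))) (iota 0 (size m))]) eight_matrices.
Proof. by lazy. Qed.

Lemma eight_enum (i : 'I_(size eight)) (H := nth K3bi eight i) :
  exists t : seq (dv H), [/\ uniq t, forall x, x \in t, irreflexive (darc H)
                          & rows (darc H) t = nth [::] eight_matrices i].
Proof.
have full (T : finType) (t : seq T) : uniq t -> size t = #|T| -> forall x, x \in t.
  move=> ut szt x; have := subset_cardP _ (subset_predT (mem t)).
  by rewrite (card_uniqP ut) szt => ->.
have main (K : fdigraph) (t : seq (dv K)) m : uniq t -> size t = #|dv K| ->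
    all (fun x => ~~ darc K x x) t -> rows (darc K) t = m ->
    exists t' : seq (dv K), [/\ uniq t', forall x, x \in t', irreflexive (darc K)
                             & rows (darc K) t' = m].
  move=> ut szt irr rt; exists t; split => //; first exact: full.
  by move=> x; apply/negbTE/(allP irr)/full.
pose l2 : seq 'I_2 := [:: @Ordinal 2 0 isT; @Ordinal 2 1 isT].
pose l3 : seq 'I_3 := [:: @Ordinal 3 0 isT; @Ordinal 3 1 isT; @Ordinal 3 2 isT].
pose glue (X Y : Type) (a : seq X) (b : seq Y) :=
  None :: map (fun x => Some (inl x)) a ++ map (fun y => Some (inr y)) b.
rewrite /H; case: i {H} => -[|[|[|[|[|[|[|[|//]]]]]]]] //= _.
- by apply: (main K3bi l3); rewrite ?card_ord.
- by apply: (main W3 [:: @Ordinal 4 0 isT; @Ordinal 4 1 isT; @Ordinal 4 2 isT;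
    @Ordinal 4 3 isT]); rewrite ?card_ord.
- by apply: (main H5 [:: @Ordinal 5 0 isT; @Ordinal 5 1 isT; @Ordinal 5 2 isT;
    @Ordinal 5 3 isT; @Ordinal 5 4 isT]); rewrite ?card_ord.
- by apply: (main (Rdig K2bi K2bi) (glue _ _ l2 l2));
    rewrite ?card_option ?card_sum ?card_ord.
- by apply: (main (Rdig K2bi C3) (glue _ _ l2 l3));
    rewrite ?card_option ?card_sum ?card_ord.
- by apply: (main (Rdig C3 K2bi) (glue _ _ l3 l2));
    rewrite ?card_option ?card_sum ?card_ord.
- by apply: (main (Rdig C3 C3) (glue _ _ l3 l3));
    rewrite ?card_option ?card_sum ?card_ord.
- by apply: (main P7 [:: @Ordinal 7 0 isT; @Ordinal 7 1 isT; @Ordinal 7 2 isT;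
    @Ordinal 7 3 isT; @Ordinal 7 4 isT; @Ordinal 7 5 isT; @Ordinal 7 6 isT]);
    rewrite ?card_ord.
Qed.

(** Preimages of [t] under an isomorphism enumerate V with the same matrix; conversely, matching
    positions in the two enumerations gives the isomorphism. *)
Lemma diso_rows (V : finType) (A : rel V) (H : fdigraph) (t : seq (dv H)) :
  irreflexive A -> irreflexive (darc H) -> uniq t -> (forall x, x \in t) ->
  t != [::] ->
  diso (FDigraph A) H <->
  exists s, [/\ uniq s, forall x, x \in s & rows A s = rows (darc H) t].
Proof.
move=> irrA irrH ut ft; case: t ut ft => // y0 t'; set t := y0 :: t' => ut ft _.
split=> [[f [[g fK gK] /= fA]]|[s [us fs st]]].
  exists (map g t); split.
  - by rewrite map_inj_uniq //; apply: can_inj gK.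
  - by move=> x; apply/mapP; exists (f x).
  by rewrite rows_map; apply: eq_rows => x y; rewrite fA !gK.
have szst : size s = size t by rewrite -(size_rows A) st size_rows.
case: s us fs st szst => // x0 s'; set s := x0 :: s' => us fs st szst.
have lt x : index x s < size t by rewrite -szst index_mem.
have ls y : index y t < size s by rewrite szst index_mem.
exists (fun x => nth y0 t (index x s)); split.
  exists (fun y => nth x0 s (index y t)) => [x|y].
    by rewrite index_uniq // nth_index.
  by rewrite index_uniq // nth_index.
move=> x y; have := get_rows irrH y0 (lt x) (lt y).
by rewrite -st (get_rows irrA x0) ?index_mem // !nth_index // => -[].
Qed.

Lemma diso_degrees (G H : fdigraph) (s : seq (dv G)) (t : seq (dv H)) :
  uniq s -> (forall x, x \in s) -> uniq t -> (forall x, x \in t) -> diso G H ->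
  perm_eq (degrees (darc G) s) (degrees (darc H) t).
Proof.
move=> us fs ut ft [f [[g fK gK] fA]].
rewrite (eq_in_degrees (e' := fun x y => darc H (f x) (f y))) => [|x y _ _ //].
rewrite -degrees_map; apply/perm_degrees/uniq_perm => //.
  by rewrite map_inj_uniq //; apply: can_inj fK.
by move=> y; rewrite ft; apply/mapP; exists (g y).
Qed.

(** * From matrices to criticality *)

Lemma eight_matrixP (m : lmatrix) : m \in eight_matrices ->
  [/\ 1 < size m, all (all (fun l => l.1 || l.2)) m, colourings m = [::] &
      forall u v, u < size m -> v < size m -> (get m u v).1 -> labels m u v != [::]].
Proof.
move/(allP eight_matrices_critical) => /and4P[sz sc /eqP col /allP lab]; split => // u v lu lv.
have /lab/allP : u \in iota 0 (size m) by rewrite mem_iota.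
by move=> /(_ v); rewrite mem_iota => /(_ lv) /implyP.
Qed.

Lemma rows_semicomplete (V : finType) (A : rel V) s : (forall x, x \in s) ->
  all (all (fun l => l.1 || l.2)) (rows A s) -> semicomplete A.
Proof.
move=> fs h x y nxy; move: (fs x) (fs y); move: h; clear fs.
elim: s => // z s IH /= /andP[/allP hz hs]; rewrite !inE.
case/predU1P=> [xz|xs] /predU1P[yz|ys]; last exact: IH.
- by rewrite xz yz eqxx in nxy.
- by have := hz (link_of A z y) (map_f _ ys); rewrite xz.
- by have := hz (link_of A z x) (map_f _ xs); rewrite yz /= orbC.
Qed.

(** A nonempty list of labels yields a colouring of D minus the arc, which [good_dicolourable]
    passes on to the proper subdigraphs. *)
Lemma critical_of_matrix (V : finType) (A : rel V) s : irreflexive A ->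
  uniq s -> (forall x, x \in s) -> rows A s \in eight_matrices ->
  dicritical3 A /\ semicomplete A.
Proof.
move=> irr us fs /eight_matrixP[sz scm col lab]; rewrite size_rows in sz lab.
have sc : semicomplete A := rows_semicomplete fs scm.
split => //; split.
  case/(dicolourable_good irr) => c gc.
  suff /(colourings_rows irr) : good A c s by rewrite col.
  by move=> x y z _ _ _; apply: gc; rewrite mem_enum inE.
have x0 : V by case: (s) sz => [|x].
have arc x y : A x y -> exists c, forall u v w, ~~ mono (delarc A x y) c u v w.
  move=> axy; have lx : index x s < size s by rewrite index_mem.
  have ly : index y s < size s by rewrite index_mem.
  have := lab _ _ lx ly; rewrite (get_rows irr x0) // !nth_index // => /(_ axy).
  have nxy : index x s != index y s.
    apply: contraTneq axy => /(congr1 (nth x0 s)); rewrite !nth_index // => ->.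
    by rewrite irr.
  case E: (labels _ _ _) => [//|f fs'] _.
  have : f \in labels (rows A s) (index x s) (index y s) by rewrite E mem_head.
  rewrite mem_filter (delete_arc_rows _ x0) // !nth_index // => /andP[_].
  rewrite mem_colourings size_rows => /andP[/eqP szf prf].
  exists (colour_of s f xpredT) => u v w.
  have irr' : irreflexive (delarc A x y) by apply: irr_delarc.
  have /(proper_rows irr') gf : proper (rows (delarc A x y) s) (map (colour_of s f xpredT) s).
    by rewrite map_colour_of.
  exact: gf.
move=> S B BA [/eqP|[x [y /andP[axy nbxy]]]].
  move=> nS; have [x xS] : exists x, x \notin S.
    apply/existsP; rewrite -negb_forall; apply/negP => /forallP h.
    by apply: nS; apply/setP => x; rewrite h inE.
  (* There are at least two vertices, so semicompleteness provides an arc at x, and the subdigraph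
     on [S] misses it. *)
  have [y xy] : exists y, x != y.
    move: sz us (fs x); case: (s) => [|z1 [|z2 s']] //= _ /andP[+ _] _.
    rewrite inE negb_or => /andP[z12 _].
    by have [xz1|] := eqVneq x z1; [exists z2; rewrite xz1 | exists z1].
  case/orP: (sc x y xy) => a; have [c gc] := arc _ _ a; apply: good_dicolourable gc _ => //
    p q pS qS /BA apq; rewrite /delarc apq xpair_eqE /=; apply/negP => /andP[/eqP h /eqP h'].
    by rewrite -h pS in xS.
  by rewrite -h' qS in xS.
have [c gc] := arc _ _ axy; apply: good_dicolourable gc _ => // p q _ _ bpq.
rewrite /delarc (BA _ _ bpq) xpair_eqE /=; apply: contraNN nbxy => /andP[/eqP <- /eqP <-] //.
Qed.

(** * From criticality to the eight digraphs *)

Lemma dicritical_semicomplete_eight (V : finType) (A : rel V) : irreflexive A ->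
  dicritical3 A -> semicomplete A ->
  exists i : 'I_(size eight), diso (FDigraph A) (nth K3bi eight i).
Proof.
move=> irr [ncol crit] sc; set G := exists i, _.
have ncolour c : ~ (forall x y z, ~~ mono A c x y z).
  move=> gc; apply: ncol; exists c => k.
  apply: (acyclic_sub (r' := fun x y => [&& c x == k, c y == k & A x y])).
    by move=> x y /and5P[_ _ -> -> ->].
  apply: good_acyclic gc => // x y z t; rewrite /= !inE !negb_or.
  by move=> /and3P[/and3P[_ /sc h _] _ _]; rewrite orbA h.
have acrit u v : A u v -> exists c, forall x y z, ~~ mono (delarc A u v) c x y z.
  move=> auv; have [||c gc] := @dicolourable_good V (delarc A u v) [set: V].
  - exact: irr_delarc.
  - apply: crit => [x y /andP[] //|].
    by right; exists u, v; rewrite auv /delarc eqxx andbF.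
  - by exists c => x y z; apply: gc; rewrite mem_enum inE.
(* An induced copy of one of the eight spans D: otherwise it would be a proper subdigraph, hence
   2-dicolourable, although its matrix has no colouring. *)
have base m : m \in eight_matrices -> refuted A G m.
  move=> me s us sm; have [sz scm col lab] := eight_matrixP me.
  have fs x : x \in s.
    apply/negPn/negP => xs; case: (@dicolourable_good V A [set y in s] irr) => [|c gc].
      by apply: crit => //; left; apply/eqP => /setP/(_ x); rewrite !inE (negbTE xs).
    suff /(colourings_rows irr) : good A c s by rewrite sm col.
    by move=> p q r ps qs rs; apply: gc; rewrite mem_enum inE.
  have li : index m eight_matrices < size eight.
    by rewrite -[size eight]/(size eight_matrices) index_mem.
  have [t [ut ft irrt rt]] := eight_enum (Ordinal li); exists (Ordinal li).
  rewrite /= nth_index // in rt.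
  apply/(diso_rows irr irrt ut ft); last by exists s; rewrite sm rt.
  by apply: contraTneq sz => t0; rewrite -rt t0.
have [/existsP[x /existsP[y /andP[xy yx]]]|nodig] :=
    boolP [exists x, exists y, A x y && A y x].
  have ref := check_nodes_sound x irr ncolour acrit _ digon_nodes_ok base.
  apply: (ref _ (decode [:: [:: 3]; [::]]) _ [:: x; y]).
  - by move=> p q /sc; rewrite /link_of; case: (A p q); case: (A q p).
  - by rewrite -[decode _]/(last [::] [seq decode (node_matrix nd) | nd <- digon_nodes]) /=
      !inE eqxx !orbT.
  - by rewrite /= inE andbT; apply: contraTneq xy => ->; rewrite irr.
  - by rewrite /= /link_of xy yx.
have nodg x y : A x y -> ~~ A y x.
  move=> xy; apply: contraNN nodig => yx.
  by apply/existsP; exists x; apply/existsP; exists y; rewrite xy yx.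
(* Without digons D is a tournament, and the second search starts from any directed triangle. *)
have [/existsP[x /existsP[y /existsP[z /and3P[xy yz zx]]]]|notri] :=
    boolP [exists x, exists y, exists z, [&& A x y, A y z & A z x]].
  have ref := check_nodes_sound x irr ncolour acrit _ triangle_nodes_ok base.
  have ne a b : A a b -> a != b by apply: contraTneq => ->; rewrite irr.
  (* In the order z, y, x the links are 2 and 1 from z, then 2 from y, as in the last node. *)
  apply: (ref _ (decode [:: [:: 2; 1]; [:: 2]; [::]]) _ [:: z; y; x]).
  - move=> p q /sc; rewrite /link_of; have := nodg p q.
    by case: (A p q) => [/(_ isT)/negbTE->|_ /= ->].
  - by rewrite /= !inE eqxx !orbT.
  - by rewrite /= !inE negb_or (ne _ _ zx) eq_sym (ne _ _ yz) eq_sym (ne _ _ xy).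
  - rewrite /= /link_of xy yz zx (negbTE (nodg _ _ xy)) (negbTE (nodg _ _ yz)).
    by rewrite (negbTE (nodg _ _ zx)).
(* With neither digon nor triangle, the constant colouring would be a 2-dicolouring. *)
case: (ncolour xpredT) => x y z; rewrite /mono /=; apply/negP => /andP[xy].
rewrite (negbTE (nodg _ _ xy)) /= => /andP[yz zx]; move/negP: notri; apply.
by apply/existsP; exists x; apply/existsP; exists y; apply/existsP; exists z; rewrite xy yz.
Qed.

Theorem theorem10 :
  (forall (V : finType) (A : rel V), irreflexive A ->
     (dicritical3 A /\ semicomplete A <->
      exists i : 'I_(size eight), diso (@FDigraph V A) (nth K3bi eight i)))
  /\
  (forall i j : 'I_(size eight), i != j ->
     ~ diso (nth K3bi eight i) (nth K3bi eight j)).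
Proof.
split=> [V A irr|i j nij ij].
  split=> [[]|[i iso]]; first exact: dicritical_semicomplete_eight.
  have [t [ut ft irrt rt]] := eight_enum i.
  have mi : nth [::] eight_matrices i \in eight_matrices.
    by apply: mem_nth; rewrite -[size _]/(size eight).
  have [sz _ _ _] := eight_matrixP mi.
  have t0 : t != [::] by apply: contraTneq sz => t0; rewrite -rt t0.
  have [s [us fs st]] := (diso_rows irr irrt ut ft t0).1 iso.
  by apply: (critical_of_matrix irr us fs); rewrite st rt.
have [s [us fs irrs rs]] := eight_enum i; have [t [ut ft irrt rt]] := eight_enum j.
have := diso_degrees us fs ut ft ij; rewrite !degrees_rows // rs rt.
have /allP/(_ (val i)) := eight_matrices_nonisomorphic.
rewrite mem_iota ltn_ord => /(_ isT)/allP/(_ (val j)).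
by rewrite mem_iota ltn_ord => /(_ isT); rewrite (inj_eq val_inj) (negbTE nij) /= => /negbTE->.
Qed.
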